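(* Let $\ell:\mathbb R^{n_w}\to\mathbb R$ be a differentiable convex function whose epigraph does not contain a line, and let $\mathcal W\subseteq\mathbb R^{n_w}$ be a nonempty set (the featured domain). For a given $P\in\mathbb R$ with $P\ge\bar P_{\ell,\mathcal W}$, let $$\hat\ell(\bm w)=\min_{\bm y\in\mathbb R^2}\left\{y_1+Py_2\ :\ \bm B\begin{bmatrix}y_1\\ y_2\end{bmatrix}\succeq_{\mathcal K}\begin{bmatrix}-\bm w\\-P\\0\\1\end{bmatrix}\right\},\qquad \bm B=\begin{bmatrix}\bm 0&\bm 0\\1&0\\0&1\\0&1\end{bmatrix}\in\mathbb R^{(n_w+3)\times2},$$ where $\mathcal K=\mathcal K_\ell\times\mathbb R_+$. Then $\hat\ell(\bm w)\le\ell(\bm w)$ for all $\bm w\in\mathbb R^{n_w}$, and $\hat\ell(\bm w)=\ell(\bm w)$ for all $\bm w\in\mathcal W$. Moreover, the minimization problem defining $\hat\ell$ has complete and bounded recourse.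
   Context: The perspective depth of $\ell$ on $\mathcal W$ is $\bar P_{\ell,\mathcal W}=\sup_{\bm u\in\mathcal W}\{\nabla\ell(\bm u)^\top\bm u-\ell(\bm u)\}$. The perspective cone of $\ell$ is $\mathcal K_\ell=\{(\bm w,v_1,v_2)\in\mathbb R^{n_w}\times\mathbb R\times\mathbb R_+: v_2\,\ell(\bm w/v_2)\le v_1\}$, where for $v_2=0$ one sets $0\,\ell(\bm w/0)=\sup_{\bm u\in\mathbb R^{n_w}}\nabla\ell(\bm u)^\top\bm w$. The epigraph of $\ell$ is $\{(\bm w,v)\in\mathbb R^{n_w}\times\mathbb R:\ell(\bm w)\le v\}$. For a cone $\mathcal K$, $\bm u\succeq_{\mathcal K}\bm v$ means $\bm u-\bm v\in\mathcal K$. ''min'' denotes the optimal value. A problem $\min\{\bm d^\top\bm y:\bm B\bm y\succeq_{\mathcal K}\text{(right-hand side)}\}$ has complete recourse if for every vector $\bm v$ (of the dimension of the right-hand side) there exists $\bm y$ with $\bm B\bm y\succeq_{\mathcal K}\bm v$. It has bounded recourse if there is no $\bm y$ with $\bm B\bm y\succeq_{\mathcal K}\bm 0$ and $\bm d^\top\bm y<0$. Here $\bm d=(1,P)^\top$. *)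

(* Defs.v *)
From HB Require Import structures.
From mathcomp Require Import all_boot all_order all_algebra.
From mathcomp Require Import all_classical all_reals all_analysis.

Set Implicit Arguments.
Unset Strict Implicit.
Unset Printing Implicit Defensive.

Import Order.TTheory GRing.Theory Num.Theory.
Import numFieldNormedType.Exports.

Local Open Scope classical_set_scope.
Local Open Scope ring_scope.

Definition dotv (R : realType) (n : nat) (a b : 'cV[R]_n) : R :=
  (a^T *m b) 0 0.

Definition grad (R : realType) (n : nat) (l : 'cV[R]_n -> R) (u : 'cV[R]_n) :
    'cV[R]_n :=
  \col_(i < n) 'D_(delta_mx i 0) l u.

Definition epigraph (R : realType) (n : nat) (l : 'cV[R]_n -> R) :
    set ('cV[R]_n * R^o) :=
  [set x | l x.1 <= x.2].

Definition contains_line (R : realType) (V : lmodType R) (A : set V) : Prop :=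
  exists a d : V, d != 0 /\ forall t : R, A (a + t *: d).

Definition perspective_depth (R : realType) (n : nat) (l : 'cV[R]_n -> R)
    (W : set 'cV[R]_n) : \bar R :=
  ereal_sup [set (dotv (grad l u) u - l u)%:E | u in W].

(* The value [t l(w / t)]. At [t = 0] it may be [+oo]; it is only used for
   [0 <= t]. *)
Definition perspective (R : realType) (n : nat) (l : 'cV[R]_n -> R)
    (w : 'cV[R]_n) (t : R) : \bar R :=
  if t == 0 then ereal_sup [set (dotv (grad l u) w)%:E | u in [set: 'cV[R]_n]]
  else (t * l (t^-1 *: w))%:E.

(* The triple [(w, v1, v2)] is the stacked column vector of size n + 1 + 1. *)
Definition perspective_cone (R : realType) (n : nat) (l : 'cV[R]_n -> R) :
    set 'cV[R]_(n + 1 + 1) :=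
  [set x : 'cV[R]_(n + 1 + 1) | let w := usubmx (usubmx x) in
           let v1 := dsubmx (usubmx x) 0 0 in
           let v2 := dsubmx x 0 0 in
           0 <= v2 /\ (perspective l w v2 <= v1%:E)%E].

Definition nonneg_cone (R : realType) : set 'cV[R]_1 := [set x | 0 <= x 0 0].

Definition prod_cone (R : realType) (m p : nat)
    (K1 : set 'cV[R]_m) (K2 : set 'cV[R]_p) : set 'cV[R]_(m + p) :=
  [set x : 'cV[R]_(m + p) | K1 (usubmx x) /\ K2 (dsubmx x)].

Definition cone_ge (R : realType) (m : nat) (K : set 'cV[R]_m)
    (u v : 'cV[R]_m) : Prop := K (u - v).

(* The optimal value of [min { d^T y : B y >=_K h }], as an infimum in the
   extended reals ([+oo] if infeasible, [-oo] if unbounded). *)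
Definition conic_value (R : realType) (m k : nat) (K : set 'cV[R]_m)
    (B : 'M[R]_(m, k)) (d : 'cV[R]_k) (h : 'cV[R]_m) : \bar R :=
  ereal_inf [set (dotv d y)%:E | y in [set y | cone_ge K (B *m y) h]].

Definition complete_recourse (R : realType) (m k : nat) (K : set 'cV[R]_m)
    (B : 'M[R]_(m, k)) : Prop :=
  forall v : 'cV[R]_m, exists y : 'cV[R]_k, cone_ge K (B *m y) v.

Definition bounded_recourse (R : realType) (m k : nat) (K : set 'cV[R]_m)
    (B : 'M[R]_(m, k)) (d : 'cV[R]_k) : Prop :=
  ~ exists y : 'cV[R]_k, cone_ge K (B *m y) 0 /\ dotv d y < 0.

Definition rec_cone (R : realType) (n : nat) (l : 'cV[R]_n -> R) :
    set 'cV[R]_(n + 1 + 1 + 1) :=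
  prod_cone (perspective_cone l) (@nonneg_cone R).

Definition rec_mx (R : realType) (n : nat) : 'M[R]_(n + 1 + 1 + 1, 1 + 1) :=
  col_mx (col_mx (col_mx 0 (row_mx 1%:M 0)) (row_mx 0 1%:M)) (row_mx 0 1%:M).

Definition rec_cost (R : realType) (P : R) : 'cV[R]_(1 + 1) :=
  col_mx 1%:M P%:M.

Definition rec_rhs (R : realType) (n : nat) (P : R) (w : 'cV[R]_n) :
    'cV[R]_(n + 1 + 1 + 1) :=
  col_mx (col_mx (col_mx (- w) (- P)%:M) 0) 1%:M.

Definition lhat (R : realType) (n : nat) (l : 'cV[R]_n -> R) (P : R)
    (w : 'cV[R]_n) : \bar R :=
  conic_value (rec_cone l) (rec_mx R n) (rec_cost P) (rec_rhs P w).

(* Main.v *)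
Require Import Defs.
From HB Require Import structures.
From mathcomp Require Import all_boot all_order all_algebra.
From mathcomp Require Import all_classical all_reals all_analysis.
From mathcomp Require Import ring lra.
Import Order.TTheory GRing.Theory Num.Theory.
Import numFieldNormedType.Exports.
Local Open Scope classical_set_scope.
Local Open Scope ring_scope.

(** Written out, the problem defining [lhat l P w] is to minimize [y1 + P * y2]
subject to [perspective l w y2 <= y1 + P] and [1 <= y2].

The point [y2 = 1], [y1 = l w - P] is feasible and costs [l w], which gives
[lhat <= l] everywhere. The rest is a lower bound on the cost, and it comes
from one inequality. At a point [u], the convex differentiable function [l]
lies above its tangent, [l u + grad l u . (v - u) <= l v]
([convex_tangent]). Taking [v = w / t] and multiplying by [t > 0] gives
[grad l u . w - t * D u <= perspective l w t], where
[D u = grad l u . u - l u] is the quantity whose supremum is the perspective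
depth. The inequality persists at [t = 0], where the perspective is by
definition the supremum over [u] of [grad l u . w]
([perspective_ge_tangent]).

- If [w] lies in [W], the choice [u = w] bounds the cost of a feasible [y]
  from below by [l w + (y2 - 1) * (P - D w)]. This is at least [l w], as
  [1 <= y2] and [D w] is at most the perspective depth, hence at most [P].
- For bounded recourse, a direction [y] satisfies
  [perspective l 0 y2 <= y1] and [0 <= y2]. Any [u] in the nonempty set [W]
  gives [- y2 * D u <= y1], hence [0 <= y1 + P * y2].
- For complete recourse, [y2] is taken large enough for the argument of the
  perspective to be positive; the perspective is then a finite number, and
  [y1] can be taken to be above it. *)

Lemma dotvDr {R : realType} {n : nat} (a b c : 'cV[R]_n) :
  dotv a (b + c) = dotv a b + dotv a c.
Proof. by rewrite /dotv mulmxDr mxE. Qed.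

Lemma dotvZr {R : realType} {n : nat} (a b : 'cV[R]_n) (t : R) :
  dotv a (t *: b) = t * dotv a b.
Proof. by rewrite /dotv -scalemxAr mxE. Qed.

Lemma dotvE {R : realType} {n : nat} (a h : 'cV[R]_n) :
  dotv a h = \sum_(i < n) h i 0 * a i 0.
Proof. by rewrite /dotv mxE; apply: eq_bigr => i _; rewrite mxE mulrC. Qed.

Lemma derive_dotv_grad {R : realType} {n : nat} {l : 'cV[R]_n -> R}
    {u : 'cV[R]_n} (h : 'cV[R]_n) :
  differentiable l u -> 'D_h l u = dotv (grad l u) h.
Proof.
move=> dl; rewrite deriveE// dotvE.
rewrite [in LHS](matrix_sum_delta h) linear_sum; apply: eq_bigr => i _.
by rewrite big_ord1 linearZ/= mxE deriveE.
Qed.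

(** Restates convexity for a real weight with explicit bounds, in place of a
weight packaged in the type [{i01 R}] with its interval membership. *)
Lemma convex_function_lerp {R : realType} {V : lmodType R} {f : V -> R}
    (t : R) (x y : V) :
  convex_function [set: V] f -> 0 <= t -> t <= 1 ->
  f (t *: x + (1 - t) *: y) <= t * f x + (1 - t) * f y.
Proof.
move=> cvxf t0 t1.
have ht : Itv.spec (@Itv.num_sem R) (Itv.Real `[0%Z, 1%Z]) t.
  by rewrite /Itv.spec/= /Itv.num_sem/= in_itv/= t0 t1 num_real.
by have := cvxf (Itv.mk ht) x y; apply; rewrite inE.
Qed.

(** By convexity the difference quotients of [l] at [u] in the direction
[v - u], for steps in ]0, 1], are at most [l v - l u]; so is their limit, which
is the directional derivative [dotv (grad l u) (v - u)]. *)
Lemma convex_tangent {R : realType} {n : nat} {l : 'cV[R]_n -> R}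
    {u : 'cV[R]_n} (v : 'cV[R]_n) :
  convex_function [set: 'cV[R]_n] l -> differentiable l u ->
  l u + dotv (grad l u) (v - u) <= l v.
Proof.
move=> cvxl dl; rewrite -lerBrDl -derive_dotv_grad//.
have dlv : derivable l u (v - u) by exact: diff_derivable.
(* Only positive steps are controlled by convexity, so the two-sided limit is
   first replaced by the right one. *)
rewrite /derive (cvg_at_rightE _ _ dlv); apply: limr_le.
  have /cvg_ex[d quot_d] := dlv; apply/cvg_ex; exists d.
  apply: cvg_trans quot_d; apply: cvg_app => A [e e0 Ae].
  by exists e => // x xe x0; apply: Ae => //; exact: lt0r_neq0.
near=> h.
have h0 : 0 < h by near: h; exact: nbhs_right_gt.
have h1 : h <= 1 by near: h; apply: nbhs_right_le.
rewrite /= /GRing.scale/= mulrC ler_pdivrMr//.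
have -> : h *: (v - u) + u = h *: v + (1 - h) *: u.
  by rewrite scalerBr scalerBl scale1r -addrA [_ + u]addrC.
have := convex_function_lerp h v u cvxl (ltW h0) h1; lra.
Unshelve. all: by end_near.
Qed.

(** The function [w, t |-> dotv (grad l u) w - t * (dotv (grad l u) u - l u)] is
the perspective of the tangent of [l] at [u]. Its validity at [t = 0] as well
is what makes separate arguments for the boundary of the perspective cone
unnecessary. *)
Lemma perspective_ge_tangent {R : realType} {n : nat} {l : 'cV[R]_n -> R}
    (u w : 'cV[R]_n) (t : R) :
  convex_function [set: 'cV[R]_n] l -> differentiable l u -> 0 <= t ->
  ((dotv (grad l u) w - t * (dotv (grad l u) u - l u))%:E <=
    perspective l w t)%E.
Proof.
move=> cvxl dl t0; rewrite /perspective; case: eqVneq => [->|tn0].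
  by rewrite mul0r subr0; apply: ereal_sup_ubound; exists u.
have tgt0 : 0 < t by rewrite lt_neqAle eq_sym tn0.
have := convex_tangent (t^-1 *: w) cvxl dl.
rewrite -(ler_pM2l tgt0) lee_fin; apply: le_trans.
rewrite -(scaleN1r u) dotvDr !dotvZr !mulrDr mulVKf//; lra.
Qed.

(** Unfolds the conic constraint into scalar inequalities for an arbitrary
right-hand side, so that it serves the problem itself and both recourse
properties. *)
Lemma cone_ge_recE {R : realType} {n : nat} {l : 'cV[R]_n -> R}
    {y : 'cV[R]_(1 + 1)} {a : 'cV[R]_n} {b c e : 'cV[R]_1} :
  cone_ge (rec_cone l) (rec_mx R n *m y)
    (col_mx (col_mx (col_mx a b) c) e) <->
  [/\ (perspective l (- a)%R (dsubmx y 0 0 - c 0 0)%R <=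
        (usubmx y 0 0 - b 0 0)%R%:E)%E,
      c 0 0 <= dsubmx y 0 0 & e 0 0 <= dsubmx y 0 0].
Proof.
rewrite -[y]vsubmxK; set y1 := usubmx y; set y2 := dsubmx y.
rewrite /cone_ge /rec_mx !mul_col_mx !mul_row_col !mul0mx !mul1mx add0r addr0.
rewrite !opp_col_mx !add_col_mx add0r /rec_cone /prod_cone /perspective_cone.
rewrite /nonneg_cone /= !(col_mxKu, col_mxKd) !mxE !subr_ge0.
by split=> [[[? ?] ?]|[? ? ?]].
Qed.

Lemma dotv_rec_cost {R : realType} (P : R) (y : 'cV[R]_(1 + 1)) :
  dotv (rec_cost P) y = usubmx y 0 0 + P * dsubmx y 0 0.
Proof.
rewrite -[y in LHS]vsubmxK /dotv /rec_cost tr_col_mx mul_row_col !tr_scalar_mx.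
by rewrite mul1mx mul_scalar_mx 2!mxE [in X in _ + X]mxE.
Qed.

Theorem theorem2 (R : realType) (n : nat) (l : 'cV[R]_n -> R)
    (l_diff : forall u : 'cV[R]_n, differentiable l u)
    (l_convex : convex_function [set: 'cV[R]_n] l)
    (l_noline : ~ contains_line (epigraph l))
    (W : set 'cV[R]_n) (W_nonempty : W !=set0)
    (P : R) (hP : (perspective_depth l W <= P%:E)%E) :
  [/\ forall w : 'cV[R]_n, (lhat l P w <= (l w)%:E)%E,
      forall w : 'cV[R]_n, W w -> lhat l P w = (l w)%:E,
      complete_recourse (rec_cone l) (rec_mx R n)
    & bounded_recourse (rec_cone l) (rec_mx R n) (rec_cost P)].
Proof.
have depth_le u : W u -> dotv (grad l u) u - l u <= P.
  move=> Wu; rewrite -lee_fin; apply: le_trans hP.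
  by apply: ereal_sup_ubound; exists u.
have lhat_le w : (lhat l P w <= (l w)%:E)%E.
  apply: ereal_inf_lbound.
  exists (col_mx (l w - P)%:M 1%:M); last first.
    by rewrite dotv_rec_cost col_mxKu col_mxKd !mxE/=; congr _%:E; ring.
  apply/cone_ge_recE; rewrite col_mxKu col_mxKd !mxE/= !mulr1n opprK.
  split=> //; rewrite /perspective subr0 oner_eq0 invr1 scale1r mul1r lee_fin; lra.
split=> //.
- move=> w Ww; apply/eqP; rewrite eq_le lhat_le/=.
  apply/ereal_infP => _ [y /cone_ge_recE y_feasible <-].
  move: y_feasible; rewrite dotv_rec_cost.
  move: (usubmx y 0 0) (dsubmx y 0 0) => y1 y2.
  rewrite !mxE/= !mulr1n !opprK subr0 => -[le_y1 _ y2_ge1].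
  have := perspective_ge_tangent w w y2 l_convex (l_diff w)
    (le_trans ler01 y2_ge1).
  move=> /le_trans/(_ le_y1); rewrite !lee_fin; have := depth_le _ Ww.
  nra.
- move=> v; rewrite -[v]vsubmxK -[usubmx v]vsubmxK -[usubmx (usubmx v)]vsubmxK.
  move: (usubmx (usubmx (usubmx v))) (dsubmx (usubmx (usubmx v))) => a b.
  move: (dsubmx (usubmx v)) (dsubmx v) => c e.
  pose y2 := Num.max (c 0 0 + 1) (e 0 0).
  have y2c : c 0 0 + 1 <= y2 by rewrite le_max lexx.
  pose t := y2 - c 0 0.
  have t_neq0 : t != 0 by rewrite gt_eqF// /t; lra.
  exists (col_mx (t * l (t^-1 *: - a) + b 0 0)%:M y2%:M).
  apply/cone_ge_recE; rewrite col_mxKu col_mxKd !mxE/= !mulr1n; split.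
  + by rewrite -/t /perspective (negbTE t_neq0) addrK.
  + lra.
  + by rewrite le_max lexx orbT.
- case=> y []; have [u Wu] := W_nonempty.
  have -> : 0 = col_mx (col_mx (col_mx 0 0) 0) 0 :> 'cV[R]_(n + 1 + 1 + 1).
    by rewrite !col_mx0.
  move=> /cone_ge_recE; rewrite dotv_rec_cost.
  move: (usubmx y 0 0) (dsubmx y 0 0) => y1 y2.
  rewrite !mxE !subr0 oppr0 => -[le_y1 y2_ge0 _].
  have := perspective_ge_tangent u 0 y2 l_convex (l_diff u) y2_ge0.
  move=> /le_trans/(_ le_y1); rewrite lee_fin -(scale0r 0) dotvZr mul0r sub0r.
  have := depth_le _ Wu.
  nra.
Qed.
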